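(* Let $f:\{-1,1\}^n\to\{-1,1\}$ be computable by a decision tree whose expected depth is $d$, and suppose $\mathbf{I}[f]\ge 1$. Let $\mathcal{X}\sim\widehat f^2$. Then $\mathbf{H}[\mathcal{X}]\le 12d\cdot\mathbf{I}[f]$.
   Context: Fourier expansion under the uniform distribution: $f=\sum_S\widehat f(S)\chi_S$, $\chi_S(x)=\prod_{i\in S}x_i$. The spectral distribution $\widehat f^2$ on subsets of $[n]$ has $\Pr[\mathcal{X}=S]=\widehat f(S)^2$, and $\mathbf{H}[\mathcal{X}]=\sum_S\widehat f(S)^2\log_2(1/\widehat f(S)^2)$. The total influence is $\mathbf{I}[f]=\sum_i\Pr_x[f(x)\ne f(x^{\oplus i})]=\sum_S|S|\widehat f(S)^2$ (uniform $x$, $x^{\oplus i}$ = $x$ with bit $i$ flipped). The expected depth of a decision tree is the expected number of variables it queries on a uniformly random input; equivalently $\sum_{v}2^{-d(v)}$ over internal (querying) nodes $v$, where $d(v)$ is the depth of $v$ with the root at depth $0$. *)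

(* Defs.v *)
From mathcomp Require Export all_boot all_order all_algebra.
From mathcomp Require Export reals exp.

Set Implicit Arguments.
Unset Strict Implicit.
Unset Printing Implicit Defensive.

Import Order.TTheory GRing.Theory Num.Theory.

Local Open Scope ring_scope.

(* The set {-1,1} is represented by bool through b |-> (-1)^b, so that false  *)
(* stands for 1 and true for -1; a function {-1,1}^n -> {-1,1} is thus a map  *)
(* cube n -> bool.                                                            *)
Definition cube (n : nat) := {ffun 'I_n -> bool}.

Definition sgn (R : realType) (b : bool) : R := (-1) ^+ b.

Definition flip (n : nat) (i : 'I_n) (x : cube n) : cube n :=
  [ffun j => if j == i then ~~ x j else x j].

(* Probability and expectation with respect to the uniform distribution.      *)
Definition Pr (R : realType) (n : nat) (A : pred (cube n)) : R :=
  #|A|%:R / 2 ^+ n.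

Definition Ex (R : realType) (n : nat) (g : cube n -> R) : R :=
  (\sum_(x : cube n) g x) / 2 ^+ n.

Definition chi (R : realType) (n : nat) (S : {set 'I_n}) (x : cube n) : R :=
  \prod_(i in S) sgn R (x i).

Definition fourier (R : realType) (n : nat) (f : cube n -> bool)
    (S : {set 'I_n}) : R :=
  Ex (fun x => sgn R (f x) * chi R S x).

Definition spectral (R : realType) (n : nat) (f : cube n -> bool)
    (S : {set 'I_n}) : R :=
  fourier R f S ^+ 2.

Definition log2 (R : realType) (x : R) : R := ln x / ln 2.

(* The convention 0 * log2 (1/0) = 0 holds because the product vanishes.      *)
Definition entropy (R : realType) (T : finType) (p : T -> R) : R :=
  \sum_(t : T) p t * log2 (1 / p t).

Definition total_influence (R : realType) (n : nat) (f : cube n -> bool) : R :=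
  \sum_(i < n) Pr R [pred x | f x != f (flip i x)].

Inductive dtree (n : nat) : Type :=
| Leaf (b : bool)
| Query (i : 'I_n) (tpos tneg : dtree n).

Arguments Leaf {n} b.

Fixpoint dt_eval (n : nat) (t : dtree n) (x : cube n) : bool :=
  match t with
  | Leaf b => b
  | Query i tpos tneg => if x i then dt_eval tneg x else dt_eval tpos x
  end.

Fixpoint dt_queries (n : nat) (t : dtree n) (x : cube n) : nat :=
  match t with
  | Leaf _ => 0
  | Query i tpos tneg =>
      (if x i then dt_queries tneg x else dt_queries tpos x).+1
  end.

(* No variable of seen is queried, and none is queried twice along a path.    *)
Fixpoint read_once_from (n : nat) (seen : {set 'I_n}) (t : dtree n) : bool :=
  match t with
  | Leaf _ => true
  | Query i tpos tneg =>
      [&& i \notin seen, read_once_from (i |: seen) tpos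
        & read_once_from (i |: seen) tneg]
  end.

(* As usual for decision trees, no root-to-leaf path repeats a variable; this *)
(* is what makes the expected number of queries equal to the sum of 2^-d(v)   *)
(* over the internal nodes v.                                                 *)
Definition read_once (n : nat) (t : dtree n) : bool := read_once_from set0 t.

Definition computes (n : nat) (t : dtree n) (f : cube n -> bool) : Prop :=
  forall x : cube n, dt_eval t x = f x.

Definition expected_depth (R : realType) (n : nat) (t : dtree n) : R :=
  Ex (fun x => (dt_queries t x)%:R).

(* Main.v *)
Require Import Defs.
From mathcomp Require Import all_boot all_order all_algebra.
From mathcomp Require Import reals exp.
From mathcomp Require Import zify ring lra.

(** Let [A_l] be the family of sets that are covered by the first [l] queries
    of the tree [t] on some input; it has at most [4 ^ l] members.  Cutting [t]
    at depth [l] and outputting [0] there leaves a function with spectrum inside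
    [A_l], so for [S] outside [A_l] the coefficient of [f] at [S] is that of
    [f * 1_{depth > l}], and by Parseval the spectral mass outside [A_l] is at
    most [Pr(depth > l)].  If [m S] is the least [l] with [S] in [A_l], summing
    over [l] gives [E(m S) <= d].  Comparing the spectral distribution with the
    weights [8 ^ - m S], whose sum is at most [2], bounds the entropy by
    [3 d + 4].  An influence of at least [1] forces [t] to make a query, so
    [d >= 1] and [3 d + 4 <= 12 d <= 12 d I]. *)

Set Implicit Arguments.
Unset Strict Implicit.
Unset Printing Implicit Defensive.

Import Order.TTheory GRing.Theory Num.Theory.

Local Open Scope ring_scope.

(** * Entropy compared with reference weights *)

Section Gibbs.

Variable R : realType.

Lemma ln_le_subr1 (x : R) : 0 < x -> ln x <= x - 1.
Proof.
move=> x0; have {1}-> : x = 1 + (x - 1) by ring.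
by apply: le_ln1Dx; lra.
Qed.

Lemma ln2_ge_half : 1 / 2 <= ln 2 :> R.
Proof.
have := @ln_le_subr1 2^-1; rewrite lnV ?posrE ?ltr0n// invr_gt0 ltr0n.
by move=> /(_ isT); lra.
Qed.

(** Gibbs' inequality, term by term, against the weights [q = 8 ^- m]: the 3 is [log2 8]. The
    weights are summed over the support only, since other sets need not be covered at any level. *)
Lemma entropy_le_code_length (T : finType) (p : T -> R) (m : T -> nat) :
  (forall t, 0 <= p t) ->
  entropy p <= 3 * (\sum_t p t * (m t)%:R)
               + 2 * \sum_(t | p t != 0) (8 ^+ m t)^-1.
Proof.
move=> p0; rewrite (big_mkcond (fun t => p t != 0)) !mulr_sumr -big_split /=.
apply: ler_sum => t _; have [->|pt0] := eqVneq (p t) 0.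
  by rewrite !mul0r !mulr0 addr0.
have {p0}pt : 0 < p t by rewrite lt_def pt0 p0.
have q0 : 0 < 8 ^+ m t :> R by rewrite exprn_gt0.
have l2 := ln2_ge_half.
have l8 : ln (8 ^+ m t : R) = (m t)%:R * (3 * ln 2).
  have e8 : 8 = 2 ^+ 3 :> R by ring.
  by rewrite lnXn// -[_ *+ m t]mulr_natl e8 lnXn// -[_ *+ 3]mulr_natl.
have := @ln_le_subr1 ((8 ^+ m t)^-1 / p t).
rewrite !ln_div ?lnV ?posrE ?invr_gt0// l8 => /(_ (divr_gt0 _ pt)).
rewrite invr_gt0 => /(_ q0) lnqp.
rewrite /log2 ln_div ?posrE// ln1 mulrA ler_pdivrMr; last by lra.
set q := (8 ^+ m t)^-1 in lnqp *.
(* Dividing by [ln 2] turns [q] into at most [2 * q], whence the factor 2. *)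
have qL : 0 <= q * (ln 2 - 1 / 2).
  by rewrite mulr_ge0 ?subr_ge0// ltW// invr_gt0.
have : p t * (- ((m t)%:R * (3 * ln 2)) - ln (p t)) <= q - p t.
  have -> : q - p t = p t * (q / p t - 1) by field.
  by rewrite ler_pM2l.
by move=> /=; lra.
Qed.

End Gibbs.

(** * Characters and Parseval's identity *)

Section Fourier.

Variables (R : realType) (n : nat).
Implicit Types (x y : cube n) (S : {set 'I_n}) (g : cube n -> R).

Lemma flipK (i : 'I_n) : involutive (@flip n i).
Proof.
by move=> x; apply/ffunP => j; rewrite !ffunE; case: eqP => //; rewrite negbK.
Qed.

Lemma sgn_negb b : sgn R (~~ b) = - sgn R b.
Proof. by rewrite /sgn; case: b; rewrite /= expr0 expr1 ?opprK. Qed.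

Lemma sgn_sqr b : sgn R b ^+ 2 = 1.
Proof. by rewrite /sgn sqrr_sign. Qed.

Lemma chi_flip S x i : i \in S -> chi R S (flip i x) = - chi R S x.
Proof.
move=> iS; rewrite /chi !(bigD1 i iS) /= ffunE eqxx sgn_negb mulNr.
by congr (- (_ * _)); apply: eq_bigr => j /andP[_ /negPf ji]; rewrite ffunE ji.
Qed.

(** The sum factors over coordinates into terms [x_i y_i + 1], each 2 when the bits agree and 0 when
    they differ. *)
Lemma sum_chi_chi x y :
  \sum_S chi R S x * chi R S y = if x == y then 2 ^+ n else 0.
Proof.
transitivity (\prod_i (sgn R (x i) * sgn R (y i) + 1)).
  rewrite bigA_distr; apply: eq_bigr => S _.
  by rewrite -big_mkcond /chi -big_split.
case: eqP => [<-|/eqP xy].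
  rewrite (eq_bigr (fun=> 2)) => [|i _]; first by rewrite prodr_const card_ord.
  by rewrite -expr2 sgn_sqr.
have [i xyi] : exists i, x i != y i.
  apply/existsP; apply: contraNT xy => /existsPn H; apply/eqP/ffunP => i.
  by have := H i; rewrite negbK => /eqP.
rewrite (bigD1 i)//= (_ : _ + 1 = 0) ?mul0r//.
by move: xyi; rewrite /sgn; case: (x i); case: (y i) => //= _;
  rewrite expr0 expr1; ring.
Qed.

(** Real-valued [g] is allowed because the remainder left by truncation also takes the value 0. *)
Lemma parseval g : \sum_S Ex (fun x => g x * chi R S x) ^+ 2
                   = Ex (fun x => g x ^+ 2).
Proof.
have c0 : 2 ^+ n != 0 :> R by rewrite expf_neq0 ?pnatr_eq0.
rewrite /Ex; under eq_bigr => S _ do rewrite expr_div_n expr2 big_distrlr /=.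
rewrite -mulr_suml exchange_big /=.
under eq_bigr => x _.
  rewrite exchange_big /=.
  under eq_bigr => y _.
    under eq_bigr => S _ do rewrite mulrACA.
    rewrite -mulr_sumr sum_chi_chi.
    over.
  rewrite (bigD1 x)//= eqxx big1 ?addr0; last first.
    by move=> y /negPf; rewrite eq_sym => ->; rewrite mulr0.
  over.
by rewrite -mulr_suml; field.
Qed.

End Fourier.

(** * Truncated trees, spectral tails and levels *)

Section Truncation.

Variables (n : nat).
Implicit Types (t : dtree n) (x : cube n) (S : {set 'I_n}).

Fixpoint queried t (l : nat) x : {set 'I_n} :=
  match t, l with
  | Query i tpos tneg, l'.+1 =>
      i |: (if x i then queried tneg l' x else queried tpos l' x)
  | _, _ => set0
  end.

(** The recursion enters both branches, so that it counts paths rather than inputs; only the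
    inclusion proved next is used. *)
Fixpoint covered t (l : nat) : {set {set 'I_n}} :=
  match t, l with
  | Query i tpos tneg, l'.+1 =>
      let B := covered tpos l' :|: covered tneg l' in
      B :|: [set i |: S | S in B]
  | _, _ => [set set0]
  end.

Lemma subset_queried_covered t l x S :
  S \subset queried t l x -> S \in covered t l.
Proof.
elim: t l S => [b|i tp IHp tn IHn] [|l] S /=;
  rewrite ?subset0 ?inE // => sS.
have SB : S :\ i \in covered tp l :|: covered tn l.
  rewrite inE; case: (x i) sS => sS.
    by rewrite IHn ?orbT // subDset.
  by rewrite IHp // subDset.
have [iS|iS] := boolP (i \in S).
  apply/orP; right; apply/imsetP; exists (S :\ i) => //.
  by rewrite setD1K.
have DS : S :\ i = S.
  by apply/setP => j; rewrite !inE; case: eqP => // ->; rewrite (negPf iS).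
by move: SB; rewrite inE DS => ->.
Qed.

(** Each level costs a factor 4: two branches, and [i] inside or outside the set. *)
Lemma card_covered t l : (#|covered t l| <= 4 ^ l)%N.
Proof.
elim: t l => [b|i tp IHp tn IHn] [|l] //=; rewrite ?cards1 ?expn_gt0 //.
apply: leq_trans (leq_card_setU _ _) _.
set B := _ :|: _.
have cB : (#|B| <= 4 ^ l + 4 ^ l)%N.
  by apply: leq_trans (leq_card_setU _ _) _; apply: leq_add.
have := leq_imset_card (fun S => i |: S) (mem B).
rewrite expnS => /leq_trans/(_ cB) cI.
by apply: leq_trans (leq_add cB cI) _; rewrite !addnn -!muln2 -mulnA mulnC.
Qed.

(** The first [l] answers, and whether the tree has stopped by then, depend only on the queried
    variables. The output is determined only if it has stopped. *)
Lemma flip_unqueried t l x i : i \notin queried t l x ->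
  [/\ queried t l (flip i x) = queried t l x,
      (dt_queries t (flip i x) <= l)%N = (dt_queries t x <= l)%N
    & (dt_queries t x <= l)%N -> dt_eval t (flip i x) = dt_eval t x].
Proof.
elim: t l => [b|j tp IHp tn IHn] [|l] //=.
rewrite !inE negb_or eq_sym => /andP[/negPf ji].
rewrite ffunE ji !ltnS; case: (x j) => [/IHn|/IHp] [-> -> ev].
  by split.
by split.
Qed.

(* Flipping the first variable of [S] that is not queried on [x] leaves the run
   of the truncated tree unchanged and negates the character. *)
Lemma fourier_truncation (R : realType) t l S : S \notin covered t l ->
  Ex (fun x => (if (dt_queries t x <= l)%N then sgn R (dt_eval t x) else 0)
               * chi R S x) = 0.
Proof.
move=> SA; rewrite /Ex.
pose sel (Q : {set 'I_n}) := [pick i in S :\: Q].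
pose sw x := if sel (queried t l x) is Some i then flip i x else x.
have swP x : exists2 i, i \in S & [/\ i \notin queried t l x, sw x = flip i x
    & sw (flip i x) = x].
  have [j Sj] : exists i, i \in S :\: queried t l x.
    apply/set0Pn; rewrite setD_eq0; apply: contra SA.
    exact: subset_queried_covered.
  have [i seli] : exists2 i, sel (queried t l x) = Some i
      & i \in S :\: queried t l x.
    rewrite /sel; case: pickP => [i Si|none]; first by exists i.
    by have := none j; rewrite /= Sj.
  rewrite inE => /andP[iQ iS]; exists i => //.
  (* The flipped input has the same queried set, so [sel] picks the same variable again and [sw] is
     an involution. *)
  have [Q _ _] := flip_unqueried iQ.
  by rewrite /sw Q seli; split; rewrite ?flipK.
have swK : involutive sw by move=> x; have [i _ [_ -> ]] := swP x.
apply/eqP; rewrite mulf_eq0; apply/orP; left.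
set E := \sum_x _; suff : E = - E by move=> EN; apply/eqP; lra.
rewrite {1}/E (reindex_inj (inv_inj swK)) /= /E -sumrN.
apply: eq_bigr => x _; have [i iS [iQ -> _]] := swP x.
have [_ -> ev] := flip_unqueried iQ; rewrite (chi_flip _ _ iS) mulrN.
by case: ifP => // /ev ->.
Qed.

Lemma spectral_tail (R : realType) t f l : computes t f ->
  \sum_(S | S \notin covered t l) spectral R f S
  <= Ex (fun x => (l < dt_queries t x)%N%:R).
Proof.
move=> tf; pose r x : R := if (l < dt_queries t x)%N then sgn R (f x) else 0.
have -> : Ex (fun x => (l < dt_queries t x)%N%:R) = Ex (fun x => r x ^+ 2).
  congr (_ / _); apply: eq_bigr => x _; rewrite /r.
  by case: ifP; rewrite ?sgn_sqr ?expr0n.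
rewrite -parseval [leRHS](bigID (fun S => S \notin covered t l)) /=.
apply: ler_wpDr; first by apply: sumr_ge0 => S _; apply: sqr_ge0.
apply: ler_sum => S SA; rewrite /spectral.
suff -> : fourier R f S = Ex (fun x => r x * chi R S x) by [].
(* The truncated function, whose coefficient at [S] is zero, and the remainder [r] add up to [f]. *)
rewrite -[RHS]add0r -(fourier_truncation R SA) /fourier /Ex -mulrDl -big_split.
congr (_ / _); apply: eq_bigr => x _; rewrite /= /r tf ltnNge.
by case: leqP; rewrite ?mul0r ?addr0 ?add0r.
Qed.

(* Junk value [N] when no earlier level covers [S]. *)
Definition level t (N : nat) S : nat :=
  find (fun l => S \in covered t l) (iota 0 N).

Lemma level_le t N S : (level t N S <= N)%N.
Proof. by rewrite -[leqRHS](size_iota 0); apply: find_size. Qed.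

Lemma notin_covered_lt_level t N S l :
  (l < level t N S)%N -> S \notin covered t l.
Proof.
move=> lm; have := before_find 0%N lm.
by rewrite nth_iota ?add0n => [->|] //; apply: leq_trans (level_le t N S).
Qed.

Lemma mem_covered_level t N S :
  S \in covered t N -> S \in covered t (level t N S).
Proof.
move=> SN; have := level_le t N S; rewrite leq_eqVlt => /predU1P[->//|mN].
have : has (fun l => S \in covered t l) (iota 0 N) by rewrite has_find size_iota.
by move=> /(nth_find 0%N); rewrite -/(level t N S) nth_iota.
Qed.

Lemma sum_ltn_ord (m N : nat) : (m <= N -> \sum_(l < N) (l < m) = m)%N.
Proof.
suff -> : (\sum_(l < N) (l < m) = minn m N)%N by move/minn_idPl.
elim: N => [|N IH]; first by rewrite big_ord0 minn0.
by rewrite big_ord_recr /= IH; case: (ltnP N m); lia.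
Qed.

(** A layer-cake argument on both sides: the level counts indices [l] that leave [S] uncovered, and
    the expected depth is the sum of the tails [Pr(depth > l)]. *)
Lemma sum_spectral_level (R : realType) t f N :
  computes t f -> (forall x, dt_queries t x <= N)%N ->
  \sum_S spectral R f S * (level t N S)%:R <= expected_depth R t.
Proof.
move=> tf qN; have p0 S : 0 <= spectral R f S by apply: sqr_ge0.
apply: (@le_trans _ _
  (\sum_S \sum_(l < N | S \notin covered t l) spectral R f S)).
  apply: ler_sum => S _; rewrite -{1}(sum_ltn_ord (level_le t N S)).
  rewrite natr_sum mulr_sumr [leRHS]big_mkcond; apply: ler_sum => l _.
  case: ltnP => [/notin_covered_lt_level ->|_]; first by rewrite mulr1.
  by rewrite mulr0; case: ifP.
rewrite (exchange_big_dep predT) //=.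
apply: (@le_trans _ _
  (\sum_(l < N) Ex (fun x => (l < dt_queries t x)%N%:R))).
  by apply: ler_sum => l _; apply: spectral_tail.
rewrite /expected_depth /Ex -mulr_suml exchange_big /=.
by under eq_bigr do rewrite -natr_sum sum_ltn_ord //.
Qed.

Lemma sum_half_pow (R : realType) N : \sum_(l < N) (2 ^+ l)^-1 <= 2 :> R.
Proof.
suff -> : \sum_(l < N) (2 ^+ l)^-1 = 2 - 2 * (2 ^+ N)^-1 :> R.
  by rewrite lerBlDr lerDl mulr_ge0// invr_ge0 exprn_ge0.
elim: N => [|N IH]; first by rewrite big_ord0 expr0; field.
by rewrite big_ord_recr /= IH exprS invfM; field; rewrite expf_neq0// pnatr_eq0.
Qed.

(** Charging every covered set at every level that covers it only increases the sum; level [l] then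
    contributes at most [4 ^ l / 8 ^ l = 2 ^- l]. *)
Lemma sum_level_weight (R : realType) t N (P : pred {set 'I_n}) :
  (forall S, P S -> S \in covered t N) ->
  \sum_(S | P S) (8 ^+ level t N S)^-1 <= 2 :> R.
Proof.
move=> PN; apply: le_trans (sum_half_pow R N.+1).
have w0 l : 0 <= (8 ^+ l)^-1 :> R by rewrite invr_ge0 exprn_ge0.
apply: (@le_trans _ _
  (\sum_S \sum_(l < N.+1 | S \in covered t l) (8 ^+ l)^-1)).
  rewrite [leRHS](bigID P) /=; apply: ler_wpDr.
    by apply: sumr_ge0 => S _; apply: sumr_ge0.
  apply: ler_sum => S /PN SN.
  (* The level may equal [N] itself, hence the [N.+1] terms. *)
  have mN : (level t N S < N.+1)%N by rewrite ltnS level_le.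
  rewrite (bigD1 (Ordinal mN)) /=; last exact: mem_covered_level.
  by rewrite ler_wpDr// sumr_ge0.
rewrite (exchange_big_dep predT) //=; apply: ler_sum => l _.
rewrite sumr_const -[leLHS]mulr_natl.
have -> : (2 ^+ l)^-1 = 4 ^+ l * (8 ^+ l)^-1 :> R.
  have -> : 8 = 4 * 2 :> R by ring.
  by rewrite exprMn; field; rewrite !expf_neq0 ?pnatr_eq0.
by rewrite ler_wpM2r// -natrX ler_nat card_covered.
Qed.

End Truncation.

Lemma entropy_le_expected_depth (R : realType) n (f : cube n -> bool) t :
  computes t f -> entropy (spectral R f) <= 3 * expected_depth R t + 4.
Proof.
move=> tf; pose N := (\max_x dt_queries t x)%N.
have qN x : (dt_queries t x <= N)%N by apply: leq_bigmax.
have p0 S : 0 <= spectral R f S by apply: sqr_ge0.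
apply: le_trans (entropy_le_code_length (level t N) p0) _.
(* No input makes more than [N] queries, so the spectral tail beyond [N] is zero. *)
have supp S : spectral R f S != 0 -> S \in covered t N.
  apply: contraNT => SA; rewrite eq_le p0 andbT.
  have /le_trans := spectral_tail R N tf; rewrite (bigD1 S) //= => tail.
  have /tail : Ex (fun x => (N < dt_queries t x)%N%:R) <= 0 :> R.
    by rewrite /Ex big1 ?mul0r// => x _; rewrite ltnNge qN.
  by apply: le_trans; rewrite lerDl sumr_ge0.
have w2 := sum_level_weight R supp.
have dd := sum_spectral_level R tf qN.
by lra.
Qed.

Theorem theorem1p2 (R : realType) (n : nat) (f : cube n -> bool) (d : R)
    (hd : exists t : dtree n,
        [/\ read_once t, computes t f & expected_depth R t = d])
    (hI : 1 <= total_influence R f) :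
  entropy (spectral R f) <= 12 * d * total_influence R f.
Proof.
have [t [_ tf <-]] := hd.
have d1 : 1 <= expected_depth R t.
  (* A leaf has influence 0, contradicting [hI]; otherwise every input queries the root. *)
  case: t tf => [b|i tp tn] tf.
    move: hI; rewrite /total_influence big1 ?ler10// => i _.
    by rewrite /Pr eq_card0 ?mul0r// => x; rewrite !inE -!tf eqxx.
  rewrite /expected_depth /Ex ler_pdivlMr ?exprn_gt0// mul1r.
  have -> : 2 ^+ n = \sum_(x : cube n) 1 :> R.
    by rewrite sumr_const card_ffun card_bool card_ord natrX.
  by apply: ler_sum => x _; rewrite ler1n.
apply: le_trans (entropy_le_expected_depth R tf) _.
have : 12 * expected_depth R t * 1
       <= 12 * expected_depth R t * total_influence R f.
  by apply: ler_wpM2l => //; lra.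
by move=> /(le_trans _); apply; lra.
Qed.
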